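(* Let $K$ be an algebraically closed field of characteristic zero, let $L$ be a finite-dimensional Lie superalgebra over $K$, and let $V$ be a finite-dimensional simple graded $L$-module. Then there is $u\in \mathrm{Hom}_L(V)_1$ such that $$\mathrm{Hom}_L(V)_0 = K\,\mathrm{Id},\qquad \mathrm{Hom}_L(V)_1 = K u,$$ where either $u=0$ or else $u^2=\mathrm{Id}$.
   Context: A Lie superalgebra over $K$ is a $\mathbb{Z}_2$-graded vector space $L = L_0 \oplus L_1$ with a bilinear bracket satisfying $[L_a,L_b]\subset L_{a+b}$, $[A,B] = -(-1)^{ab}[B,A]$ and $(-1)^{ac}[A,[B,C]] + (-1)^{ab}[B,[C,A]] + (-1)^{bc}[C,[A,B]] = 0$ for all $A\in L_a$, $B\in L_b$, $C\in L_c$. A graded $L$-module is a $\mathbb{Z}_2$-graded vector space $V=V_0\oplus V_1$ with a bilinear action satisfying $L_aV_b\subset V_{a+b}$ and $[A,B]v=A(Bv)-(-1)^{ab}B(Av)$ for $A\in L_a$, $B\in L_b$, $v\in V$. It is simple if it is nonzero and its only graded submodules are $0$ and $V$. For $k\in\mathbb{Z}_2$, $\mathrm{Hom}_L(V)_k$ denotes the space of linear maps $f:V\to V$ with $f(V_b)\subset V_{k+b}$ for all $b\in\mathbb{Z}_2$ and $f(Av)=(-1)^{ka}A f(v)$ for all $A\in L_a$, $a\in\mathbb{Z}_2$, $v\in V$. *)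

(* Defs.v *)
From mathcomp Require Import all_boot all_order all_algebra.

Set Implicit Arguments.
Unset Strict Implicit.
Unset Printing Implicit Defensive.

Import GRing.Theory.
Local Open Scope ring_scope.

(* Z_2 is encoded as bool: false is 0, true is 1, (+) is addition and && is
   multiplication, so that (-1) ^+ (a && b) is the sign (-1)^{ab}.
   Finite dimension is built in, as the carriers are vectTypes. *)

Definition Z2_grading (K : fieldType) (V : vectType K)
    (Vg : bool -> {vspace V}) : Prop :=
  (Vg false + Vg true)%VS = fullv /\ directv (Vg false + Vg true)%VS.

Record lieSuperalgebra (K : fieldType) := LieSuperalgebra {
  lie_carrier :> vectType K;
  lie_part : bool -> {vspace lie_carrier};
  lie_bracket : {bilinear lie_carrier -> lie_carrier -> lie_carrier};
  lie_gradingP : Z2_grading lie_part;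
  lie_bracket_part : forall (a b : bool) (A B : lie_carrier),
    A \in lie_part a -> B \in lie_part b ->
    lie_bracket A B \in lie_part (a (+) b);
  lie_antisymmetry : forall (a b : bool) (A B : lie_carrier),
    A \in lie_part a -> B \in lie_part b ->
    lie_bracket A B = - ((-1) ^+ (a && b) *: lie_bracket B A);
  lie_jacobi : forall (a b c : bool) (A B C : lie_carrier),
    A \in lie_part a -> B \in lie_part b -> C \in lie_part c ->
    (-1) ^+ (a && c) *: lie_bracket A (lie_bracket B C)
    + (-1) ^+ (a && b) *: lie_bracket B (lie_bracket C A)
    + (-1) ^+ (b && c) *: lie_bracket C (lie_bracket A B) = 0
}.

Record gradedModule (K : fieldType) (L : lieSuperalgebra K) := GradedModule {
  mod_carrier :> vectType K;
  mod_part : bool -> {vspace mod_carrier};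
  mod_act : {bilinear L -> mod_carrier -> mod_carrier};
  mod_gradingP : Z2_grading mod_part;
  mod_act_part : forall (a b : bool) (A : L) (v : mod_carrier),
    A \in lie_part L a -> v \in mod_part b -> mod_act A v \in mod_part (a (+) b);
  mod_act_bracket : forall (a b : bool) (A B : L) (v : mod_carrier),
    A \in lie_part L a -> B \in lie_part L b ->
    mod_act (lie_bracket L A B) v
      = mod_act A (mod_act B v) - (-1) ^+ (a && b) *: mod_act B (mod_act A v)
}.

Definition graded_submodule (K : fieldType) (L : lieSuperalgebra K)
    (V : gradedModule L) (W : {vspace V}) : Prop :=
  W = (W :&: mod_part V false + W :&: mod_part V true)%VS /\
  forall (A : L) (w : V), w \in W -> mod_act V A w \in W.

Definition simple_module (K : fieldType) (L : lieSuperalgebra K)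
    (V : gradedModule L) : Prop :=
  (fullv : {vspace V}) <> 0%VS /\
  forall W : {vspace V}, graded_submodule W -> W = 0%VS \/ W = fullv.

Definition super_hom (K : fieldType) (L : lieSuperalgebra K)
    (V : gradedModule L) (k : bool) (f : 'End(V)) : Prop :=
  (forall (b : bool) (v : V),
     v \in mod_part V b -> f v \in mod_part V (k (+) b)) /\
  (forall (a : bool) (A : L) (v : V), A \in lie_part L a ->
     f (mod_act V A v) = (-1) ^+ (k && a) *: mod_act V A (f v)).

(* Main.v *)
Require Import Defs.
From mathcomp Require Import all_boot all_order all_algebra.
From Stdlib Require Import Classical.

Set Implicit Arguments.
Unset Strict Implicit.
Unset Printing Implicit Defensive.

Local Open Scope ring_scope.

(** This is Schur's lemma for modules over a superalgebra.  The kernel of a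
    homogeneous homomorphism is a graded submodule, so over a simple module
    every such homomorphism is zero or injective ([super_hom_eq0_or_inj]).

    An even homomorphism f has an eigenvalue c, the field being algebraically
    closed and V finite-dimensional and nonzero; f - c Id is again an even
    homomorphism and is not injective, hence f = c Id ([even_hom_scalar]).

    The composite of two odd homomorphisms is even, hence a scalar.  If some odd
    g is nonzero then g is injective, so its square is a nonzero scalar, and
    dividing g by a square root of that scalar gives an odd u with
    u o u = Id ([exists_odd_involution]).  Any odd f is then u o (u o f), where
    u o f is an even homomorphism and thus a scalar, so f is a multiple of u. *)

Import GRing.Theory.

Section Gradings.

Variables (K : fieldType) (V : vectType K) (Vg : bool -> {vspace V}).
Hypothesis gradV : Z2_grading Vg.

Lemma grading_decomp (v : V) :
  exists w : bool -> V, (forall b, w b \in Vg b) /\ v = w false + w true.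
Proof.
have: v \in fullv by rewrite memvf.
rewrite -gradV.1 => /memv_addP[v0 v0V [v1 v1V ->]].
by exists (fun b => if b then v1 else v0); split=> // -[].
Qed.

(** Both components are treated at once, and without fixing their order, so that
    the result also serves for a map exchanging the two parts. *)
Lemma grading_add_eq0 (b : bool) (x y : V) :
  x \in Vg b -> y \in Vg (~~ b) -> x + y = 0 -> x = 0 /\ y = 0.
Proof.
move=> xV yV /eqP; rewrite addr_eq0 => /eqP xNy.
have xV' : x \in Vg (~~ b) by rewrite xNy memvN.
have : x \in (Vg false :&: Vg true)%VS.
  by rewrite memv_cap; case: b {yV} xV xV' => -> ->.
rewrite (directv_addP gradV.2) memv0 => /eqP x0.
by split=> //; apply/eqP; rewrite -oppr_eq0 -xNy x0.
Qed.

End Gradings.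

Section SuperHom.

Variables (K : fieldType) (L : lieSuperalgebra K) (V : gradedModule L).

Lemma super_hom0 (k : bool) : super_hom k (0 : 'End(V)).
Proof.
by split=> [b v _ | a A v _]; rewrite !lfunE /= ?mem0v // linear0 scaler0.
Qed.

Lemma super_hom1 : super_hom false (\1%VF : 'End(V)).
Proof. by split=> [b v | a A v _]; rewrite !lfunE //= scale1r. Qed.

Lemma super_homP (k : bool) (c : K) (f g : 'End(V)) :
  super_hom k f -> super_hom k g -> super_hom k (c *: f + g).
Proof.
move=> [fV fL] [gV gL]; split=> [b v vb | a A v Aa]; rewrite !lfunE /= !lfunE /=.
  by rewrite memvD ?memvZ ?fV ?gV.
by rewrite (fL a) // (gL a) // linearP /= scalerDr !scalerA mulrC.
Qed.

Lemma super_homZ (k : bool) (c : K) (f : 'End(V)) :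
  super_hom k f -> super_hom k (c *: f).
Proof. by move=> hf; rewrite -[c *: f]addr0; apply: super_homP (super_hom0 k). Qed.

Lemma super_hom_comp (k l : bool) (f g : 'End(V)) :
  super_hom k f -> super_hom l g -> super_hom (k (+) l) (f \o g)%VF.
Proof.
move=> [fV fL] [gV gL]; split=> [b v vb | a A v Aa]; rewrite !comp_lfunE.
  by rewrite -addbA; apply/fV/gV.
rewrite (gL a) // linearZ /= (fL a) // scalerA.
by case: k l a {fV fL gV gL Aa} => -[] [] //=; rewrite ?mulr1 ?mul1r ?mulrNN ?mulr1.
Qed.

(** The two components of a kernel vector are mapped to different parts, hence
    are killed separately, so the kernel is graded.  For its stability A is split
    into homogeneous parts, as the sign in f (A v) depends on the degree of A. *)
Lemma lker_graded_submodule (k : bool) (f : 'End(V)) :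
  super_hom k f -> graded_submodule (lker f).
Proof.
move=> [fV fL]; split=> [|A v]; last first.
  rewrite !memv_ker => /eqP fv0.
  have [B [BL ->]] := grading_decomp (lie_gradingP L) A.
  rewrite linearDl linearD /= (fL false) // (fL true) // fv0.
  by rewrite !linear0 addr0.
apply/eqP; rewrite eqEsubv subv_add !capvSl !andbT; apply/subvP=> v.
have [w [wV ->]] := grading_decomp (mod_gradingP V) v.
rewrite memv_ker linearD /= => /eqP fw0.
have fwV b : f (w b) \in mod_part V (k (+) b) by apply: fV.
have fwV1 : f (w true) \in mod_part V (~~ (k (+) false)).
  by have := fwV true; rewrite addbT addbF.
have [f0 f1] := grading_add_eq0 (mod_gradingP V) (fwV false) fwV1 fw0.
by apply: memv_add; rewrite memv_cap memv_ker ?f0 ?f1 eqxx wV.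
Qed.

Lemma super_hom_eq0_or_inj (k : bool) (f : 'End(V)) :
  simple_module V -> super_hom k f -> f = 0 \/ lker f = 0%VS.
Proof.
move=> [_ simV] hf; have [->|kerf] := simV _ (lker_graded_submodule hf).
  by right.
left; apply/lfunP=> v; rewrite lfunE /=.
by apply/eqP; rewrite -memv_ker kerf memvf.
Qed.

End SuperHom.

Lemma leigenvalue_closed (K : closedFieldType) (V : vectType K) (f : 'End(V)) :
  (fullv : {vspace V}) <> 0%VS -> exists c, passmx.leigenvalue f c.
Proof.
move=> V_neq0; set e := vbasis {:V}.
have eB : basis_of {:V} e by apply: vbasisP.
pose M := passmx.mxof e e f.
have /closed_rootP[c rc] : size (char_poly M) != 1.
  by rewrite size_char_poly eqSS dimv_eq0; apply/eqP.
exists c; rewrite /passmx.leigenvalue (passmx.leigenspaceE eB) passmx.vsof_eq0 //.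
by move: rc; rewrite -eigenvalue_root_char.
Qed.

Section Schur.

Variables (K : closedFieldType) (L : lieSuperalgebra K) (V : gradedModule L).
Hypothesis simpleV : simple_module V.

Lemma even_hom_scalar (f : 'End(V)) :
  super_hom false f -> exists c, f = c *: \1%VF.
Proof.
move=> hf; have [c /eqP eig_c] := leigenvalue_closed f simpleV.1.
exists c; apply/eqP; rewrite -subr_eq0; apply/eqP.
have hfc : super_hom false (f - c *: \1%VF).
  by rewrite addrC -scaleNr; apply: super_homP hf; apply: super_hom1.
by have [|/eig_c] := super_hom_eq0_or_inj simpleV hfc.
Qed.

Lemma exists_odd_involution (g : 'End(V)) :
  super_hom true g -> g <> 0 ->
  exists u : 'End(V), super_hom true u /\ (u \o u)%VF = \1%VF.
Proof.
move=> hg g_neq0; have [c ggE] := even_hom_scalar (super_hom_comp hg hg).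
have [//|/eqP/lker0P g_inj] := super_hom_eq0_or_inj simpleV hg.
have c_neq0 : c != 0.
  apply/eqP=> c0; apply: g_neq0; apply/lfunP=> v; apply: g_inj.
  by rewrite -comp_lfunE ggE c0 scale0r !lfunE /= linear0.
have [s s2] : exists s, s ^+ 2 = c.
  have /closed_rootP[s] : size ('X^2 - c%:P) != 1 by rewrite size_XnsubC.
  by rewrite /root !hornerE subr_eq0 => /eqP; exists s.
exists (s^-1 *: g); split; first exact: super_homZ.
rewrite -comp_lfunZl -comp_lfunZr ggE !scalerA -invfM -expr2 s2.
by rewrite mulVf // scale1r.
Qed.

End Schur.

Theorem lemma7p9 (K : closedFieldType) (charK : [pchar K] =i pred0)
    (L : lieSuperalgebra K) (V : gradedModule L) (simpleV : simple_module V) :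
  exists u : 'End(V),
    [/\ super_hom true u,
        forall f : 'End(V), super_hom false f <-> f \in <[\1%VF : 'End(V)]>%VS,
        forall f : 'End(V), super_hom true f <-> f \in <[u]>%VS
      & u = 0 \/ (u \o u)%VF = \1%VF].
Proof.
have evenE (f : 'End(V)) :
    super_hom false f <-> f \in <[\1%VF : 'End(V)]>%VS.
  split=> [hf | /vlineP[c ->]]; last exact/super_homZ/super_hom1.
  by apply/vlineP/even_hom_scalar.
have [[g [hg g_neq0]] | odd0] :=
  classic (exists g : 'End(V), super_hom true g /\ g <> 0); last first.
  exists 0; split=> //; [exact: super_hom0 | move=> f | by left].
  split=> [hf | /vlineP[c ->]]; last exact/super_homZ/super_hom0.
  by rewrite (NNPP (f = 0)) ?mem0v // => f_neq0; apply: odd0; exists f.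
have [u [hu uu]] := exists_odd_involution simpleV hg g_neq0.
exists u; split=> // [f|]; last by right.
split=> [hf | /vlineP[c ->]]; last exact: super_homZ.
have [c ufE] := even_hom_scalar simpleV (super_hom_comp hu hf).
apply/vlineP; exists c.
by rewrite -[f]comp_lfun1l -uu -comp_lfunA ufE -comp_lfunZr comp_lfun1r.
Qed.
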